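(* Let $\mathbb{C}$ be a cartesian closed category and let $\mathcal{T} = (T, \eta, \mu)$ be a (left) strong monad over $\mathbb{C}$ with left strength $\mathrm{lst}$. Let $\bar{A} = (A, f_A)$ be an object of the Eilenberg–Moore category $\mathbb{C}^{\mathcal{T}}$ and let $B$ be an object of $\mathbb{C}$. Then $$\bigl(B \Rightarrow A,\ \lambda(f_A \circ T\mathrm{ev} \circ Ts \circ \mathrm{lst} \circ s)\bigr)$$ is an object of $\mathbb{C}^{\mathcal{T}}$, where the morphism being transposed is the composite $$T(B \Rightarrow A) \times B \xrightarrow{s} B \times T(B \Rightarrow A) \xrightarrow{\mathrm{lst}} T(B \times (B \Rightarrow A)) \xrightarrow{Ts} T((B \Rightarrow A) \times B) \xrightarrow{T\mathrm{ev}} TA \xrightarrow{f_A} A .$$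
   Context: A monad $\mathcal{T} = (T, \eta, \mu)$ over $\mathbb{C}$ consists of an endofunctor $T : \mathbb{C} \to \mathbb{C}$ and natural transformations $\eta : \mathrm{id}_{\mathbb{C}} \to T$ and $\mu : T^2 \to T$ with $\mu_A \circ T\mu_A = \mu_A \circ \mu_{TA}$ and $\mu_A \circ \eta_{TA} = \mathrm{id}_{TA} = \mu_A \circ T\eta_A$ for every object $A$. The category $\mathbb{C}$ is regarded as a monoidal category via its finite products, with associator $\alpha_{A,B,C} : (A \times B) \times C \to A \times (B \times C)$, left unitor $\lambda_A = \pi_2 : \mathbf{1} \times A \to A$ and symmetry $s_{A,B} : A \times B \to B \times A$ (the swap). The monad is (left) strong if it is equipped with a natural transformation $\mathrm{lst}_{A,B} : A \times TB \to T(A \times B)$ (the left strength) such that for all objects $A, B, C$: $T(\alpha_{A,B,C}) \circ \mathrm{lst}_{A \times B, C} = \mathrm{lst}_{A, B \times C} \circ (\mathrm{id}_A \times \mathrm{lst}_{B,C}) \circ \alpha_{A,B,TC}$; $T(\lambda_A) \circ \mathrm{lst}_{\mathbf{1},A} = \lambda_{TA}$; $\mathrm{lst}_{A,B} \circ (\mathrm{id}_A \times \eta_B) = \eta_{A \times B}$; and $\mu_{A \times B} \circ T\mathrm{lst}_{A,B} \circ \mathrm{lst}_{A,TB} = \mathrm{lst}_{A,B} \circ (\mathrm{id}_A \times \mu_B)$. The exponential object is written $B \Rightarrow A$, with evaluation $\mathrm{ev} : (B \Rightarrow A) \times B \to A$; for $g : C \times B \to A$, the transpose $\lambda(g) : C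 \to (B \Rightarrow A)$ is the unique morphism with $\mathrm{ev} \circ (\lambda(g) \times \mathrm{id}_B) = g$. The Eilenberg–Moore category $\mathbb{C}^{\mathcal{T}}$ has as objects the $\mathcal{T}$-algebras, i.e. pairs $\bar{A} = (A, f_A)$ with $A$ an object of $\mathbb{C}$ and $f_A : TA \to A$ a morphism of $\mathbb{C}$ such that $f_A \circ \eta_A = \mathrm{id}_A$ and $f_A \circ \mu_A = f_A \circ T f_A$. *)

(* Defs.v *)
Set Implicit Arguments.
Unset Strict Implicit.
Unset Printing Implicit Defensive.

Declare Scope cat_scope.
Delimit Scope cat_scope with cat.
Local Open Scope cat_scope.

(* Hom-sets carry Leibniz equality. *)
Record Category := {
  ob :> Type;
  hom : ob -> ob -> Type;
  idm : forall A, hom A A;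
  comp : forall A B C, hom B C -> hom A B -> hom A C;
  comp_idl : forall A B (f : hom A B), comp (idm B) f = f;
  comp_idr : forall A B (f : hom A B), comp f (idm A) = f;
  comp_assoc : forall A B C D (h : hom C D) (g : hom B C) (f : hom A B),
    comp h (comp g f) = comp (comp h g) f
}.

Arguments hom {c} A B.
Arguments idm {c} A.
Arguments comp {c A B C} _ _.

Notation "A ~> B" := (hom A B) (at level 70, no associativity) : cat_scope.
Notation "g ∘ f" := (comp g f) (at level 40, left associativity) : cat_scope.

Record Functor (C D : Category) := {
  fob :> C -> D;
  fmap : forall A B : C, A ~> B -> fob A ~> fob B;
  fmap_id : forall A : C, fmap (idm A) = idm (fob A);
  fmap_comp : forall (A B E : C) (g : B ~> E) (f : A ~> B),
    fmap (g ∘ f) = fmap g ∘ fmap f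
}.

Arguments fmap {C D} _ {A B} _.

Definition functor_id (C : Category) : Functor C C :=
  {| fob := fun A : C => A;
     fmap := fun (A B : C) (f : A ~> B) => f;
     fmap_id := fun _ => eq_refl;
     fmap_comp := fun _ _ _ _ _ => eq_refl |}.

Definition functor_comp (C D E : Category) (G : Functor D E) (F : Functor C D) :
  Functor C E :=
  {| fob := fun A : C => G (F A);
     fmap := fun (A B : C) (f : A ~> B) => fmap G (fmap F f);
     fmap_id := fun A =>
       eq_trans (f_equal (fmap G (B := F A)) (fmap_id F A)) (fmap_id G (F A));
     fmap_comp := fun (A B X : C) (g : B ~> X) (f : A ~> B) =>
       eq_trans (f_equal (fmap G (B := F X)) (fmap_comp F g f))
                (fmap_comp G (fmap F g) (fmap F f)) |}.

Record NatTrans (C D : Category) (F G : Functor C D) := {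
  component :> forall A : C, F A ~> G A;
  naturality : forall (A B : C) (f : A ~> B),
    fmap G f ∘ component A = component B ∘ fmap F f
}.

Record Monad (C : Category) := {
  monad_functor :> Functor C C;
  eta : NatTrans (functor_id C) monad_functor;
  mu : NatTrans (functor_comp monad_functor monad_functor) monad_functor;
  monad_assoc : forall A : C,
    mu A ∘ fmap monad_functor (mu A) = mu A ∘ mu (monad_functor A);
  monad_unitl : forall A : C,
    mu A ∘ eta (monad_functor A) = idm (monad_functor A);
  monad_unitr : forall A : C,
    mu A ∘ fmap monad_functor (eta A) = idm (monad_functor A)
}.

Arguments eta {C} m.
Arguments mu {C} m.

(* Finite products are chosen structure: a terminal object and binary
   products. *)
Record CartesianCategory := {
  cart_cat :> Category;
  one : cart_cat;
  bang : forall A : cart_cat, A ~> one;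
  bang_unique : forall (A : cart_cat) (f : A ~> one), f = bang A;
  prod : cart_cat -> cart_cat -> cart_cat;
  pi1 : forall A B : cart_cat, prod A B ~> A;
  pi2 : forall A B : cart_cat, prod A B ~> B;
  pair : forall A B X : cart_cat, X ~> A -> X ~> B -> X ~> prod A B;
  pair_pi1 : forall (A B X : cart_cat) (f : X ~> A) (g : X ~> B),
    pi1 A B ∘ pair f g = f;
  pair_pi2 : forall (A B X : cart_cat) (f : X ~> A) (g : X ~> B),
    pi2 A B ∘ pair f g = g;
  pair_unique : forall (A B X : cart_cat) (f : X ~> A) (g : X ~> B)
      (h : X ~> prod A B),
    pi1 A B ∘ h = f -> pi2 A B ∘ h = g -> h = pair f g
}.

Arguments one {c}.
Arguments prod {c} A B.
Arguments pi1 {c} A B.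
Arguments pi2 {c} A B.
Arguments pair {c A B X} _ _.

Notation "A × B" := (prod A B) (at level 40, left associativity) : cat_scope.

Definition prod_map (C : CartesianCategory) (A A' B B' : C)
    (f : A ~> A') (g : B ~> B') : A × B ~> A' × B' :=
  pair (f ∘ pi1 A B) (g ∘ pi2 A B).

Notation "f ⊗ g" := (prod_map f g) (at level 39, left associativity) : cat_scope.

Definition associator (C : CartesianCategory) (X Y Z : C) :
    (X × Y) × Z ~> X × (Y × Z) :=
  pair (pi1 X Y ∘ pi1 (X × Y) Z) (pair (pi2 X Y ∘ pi1 (X × Y) Z) (pi2 (X × Y) Z)).

Definition left_unitor (C : CartesianCategory) (A : C) : one × A ~> A :=
  pi2 one A.

Definition swap (C : CartesianCategory) (A B : C) : A × B ~> B × A :=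
  pair (pi2 A B) (pi1 A B).

Record CartesianClosedCategory := {
  ccc_cart :> CartesianCategory;
  exp : ccc_cart -> ccc_cart -> ccc_cart;
  ev : forall B A : ccc_cart, exp B A × B ~> A;
  curry : forall A B X : ccc_cart, X × B ~> A -> X ~> exp B A;
  curry_ev : forall (A B X : ccc_cart) (g : X × B ~> A),
    ev B A ∘ (curry g ⊗ idm B) = g;
  curry_unique : forall (A B X : ccc_cart) (g : X × B ~> A) (h : X ~> exp B A),
    ev B A ∘ (h ⊗ idm B) = g -> h = curry g
}.

Arguments exp {c} B A.
Arguments ev {c} B A.
Arguments curry {c A B X} _.

Notation "B ⇒ A" := (exp B A) (at level 60, right associativity) : cat_scope.

Record LeftStrength (C : CartesianCategory) (T : Monad C) := {
  lst :> forall A B : C, A × T B ~> T (A × B);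
  (* naturality jointly in both arguments, i.e. as a transformation between
     functors on the product category of C with itself *)
  lst_natural : forall (A A' B B' : C) (f : A ~> A') (g : B ~> B'),
    fmap T (f ⊗ g) ∘ lst A B = lst A' B' ∘ (f ⊗ fmap T g);
  lst_assoc : forall X Y Z : C,
    fmap T (associator X Y Z) ∘ lst (X × Y) Z
    = lst X (Y × Z) ∘ (idm X ⊗ lst Y Z) ∘ associator X Y (T Z);
  lst_unit : forall A : C,
    fmap T (left_unitor A) ∘ lst one A = left_unitor (T A);
  lst_eta : forall A B : C,
    lst A B ∘ (idm A ⊗ eta T B) = eta T (A × B);
  lst_mu : forall A B : C,
    mu T (A × B) ∘ fmap T (lst A B) ∘ lst A (T B) = lst A B ∘ (idm A ⊗ mu T B)
}.

(* [is_EM_object T a]: the pair [(A, a)] is an object of the Eilenberg-Moore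
   category of [T]. *)
Record is_EM_object (C : Category) (T : Monad C) (A : C) (a : T A ~> A) : Prop := {
  em_unit : a ∘ eta T A = idm A;
  em_assoc : a ∘ mu T A = a ∘ fmap T a
}.

Arguments is_EM_object {C} T {A} a.

Record EM_object (C : Category) (T : Monad C) := {
  carrier :> C;
  action : T carrier ~> carrier;
  EM_objectP : is_EM_object T action
}.

Arguments action {C T} e.

(* Main.v *)
Require Import Defs.
Local Open Scope cat_scope.

(** Put the parameter of an exponential on the left, by evaluating along
    [flip_ev : B × (B ⇒ A) ~> A].  The structure map [k] of the statement is then
    characterised ([flip_ev_transpose]) by

      [flip_ev ∘ (idm B ⊗ k) = action A ∘ fmap T flip_ev ∘ lst],

    that is, [k] is the pointwise action of [A] with the strength
    distributing the argument over the computation.  Maps into [B ⇒ A] are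
    equal as soon as they agree after [flip_ev ∘ (idm B ⊗ -)]
    ([flip_ev_monic]), so both algebra laws become equations between maps
    into [A].  Unfolding [k] turns the unit law into the unit law of [A] via
    compatibility of the strength with [eta], and the associativity law into
    that of [A] via compatibility of the strength with [mu] and its
    naturality. *)

Lemma pair_comp (C : CartesianCategory) (A B X Y : C)
    (f : X ~> A) (g : X ~> B) (h : Y ~> X) :
  pair f g ∘ h = pair (f ∘ h) (g ∘ h).
Proof.
  apply pair_unique; rewrite comp_assoc.
  - now rewrite pair_pi1.
  - now rewrite pair_pi2.
Qed.

Lemma prod_map_pair (C : CartesianCategory) (A A' B B' X : C)
    (f : A ~> A') (g : B ~> B') (u : X ~> A) (v : X ~> B) :
  (f ⊗ g) ∘ pair u v = pair (f ∘ u) (g ∘ v).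
Proof.
  unfold prod_map.
  now rewrite pair_comp, <- !comp_assoc, pair_pi1, pair_pi2.
Qed.

Lemma prod_map_id (C : CartesianCategory) (A B : C) :
  idm A ⊗ idm B = idm (A × B).
Proof.
  symmetry; apply pair_unique; now rewrite comp_idl, comp_idr.
Qed.

Lemma prod_map_comp_r (C : CartesianCategory) (X A B D : C)
    (g : B ~> D) (f : A ~> B) :
  idm X ⊗ (g ∘ f) = (idm X ⊗ g) ∘ (idm X ⊗ f).
Proof.
  unfold prod_map at 1 3.
  now rewrite prod_map_pair, !comp_idl, comp_assoc.
Qed.

Lemma swap_involutive (C : CartesianCategory) (A B : C) :
  swap B A ∘ swap A B = idm (A × B).
Proof.
  unfold swap at 1. rewrite pair_comp. unfold swap.
  rewrite pair_pi1, pair_pi2.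
  symmetry; apply pair_unique; apply comp_idr.
Qed.

Lemma swap_natural (C : CartesianCategory) (A A' B B' : C)
    (f : A ~> A') (g : B ~> B') :
  swap A' B' ∘ (f ⊗ g) = (g ⊗ f) ∘ swap A B.
Proof.
  unfold swap. rewrite prod_map_pair, pair_comp.
  unfold prod_map. now rewrite pair_pi1, pair_pi2.
Qed.

Definition flip_ev {C : CartesianClosedCategory} (B A : C) : B × (B ⇒ A) ~> A :=
  ev B A ∘ swap B (B ⇒ A).

Lemma flip_ev_map (C : CartesianClosedCategory) (A B X : C) (h : X ~> B ⇒ A) :
  flip_ev B A ∘ (idm B ⊗ h) = ev B A ∘ (h ⊗ idm B) ∘ swap B X.
Proof.
  unfold flip_ev. now rewrite <- !comp_assoc, swap_natural.
Qed.

Lemma flip_ev_monic (C : CartesianClosedCategory) (A B X : C)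
    (h h' : X ~> B ⇒ A) :
  flip_ev B A ∘ (idm B ⊗ h) = flip_ev B A ∘ (idm B ⊗ h') -> h = h'.
Proof.
  rewrite !flip_ev_map; intros H.
  rewrite (curry_unique (g := ev B A ∘ (h' ⊗ idm B)) (h := h')) by reflexivity.
  apply curry_unique.
  (* The symmetry is invertible, hence cancels on the right. *)
  rewrite <- (comp_idr (ev B A ∘ (h ⊗ idm B))),
          <- (comp_idr (ev B A ∘ (h' ⊗ idm B))), <- swap_involutive.
  now rewrite !(comp_assoc (ev B A ∘ _)), H.
Qed.

Lemma flip_ev_curry (C : CartesianClosedCategory) (A B X : C)
    (g : B × X ~> A) :
  flip_ev B A ∘ (idm B ⊗ curry (g ∘ swap X B)) = g.
Proof.
  now rewrite flip_ev_map, curry_ev, <- comp_assoc, swap_involutive, comp_idr.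
Qed.

(** The two swaps in the transposed composite only exist to move the parameter
    to the side where the strength acts: [flip_ev] absorbs one and cancels the
    other. *)
Lemma flip_ev_transpose (C : CartesianClosedCategory) (T : Monad C)
    (lst : LeftStrength T) (A B : C) (a : T A ~> A) :
  flip_ev B A ∘
    (idm B ⊗ curry (a ∘ fmap T (ev B A) ∘ fmap T (swap B (B ⇒ A))
                    ∘ lst B (B ⇒ A) ∘ swap (T (B ⇒ A)) B))
  = a ∘ fmap T (flip_ev B A) ∘ lst B (B ⇒ A).
Proof.
  rewrite flip_ev_curry. unfold flip_ev.
  now rewrite fmap_comp, !comp_assoc.
Qed.

(** Under [flip_ev ∘ (idm B ⊗ -)] both sides of the associativity law become
    [a] after two layers of [T]: the side with [mu T] through [lst_mu], the side
    with [fmap T k] through [lst_natural]; [a]'s own associativity law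
    identifies them. *)
Lemma pointwise_action_is_EM_object (C : CartesianClosedCategory) (T : Monad C)
    (lst : LeftStrength T) (A B : C) (a : T A ~> A) (k : T (B ⇒ A) ~> B ⇒ A) :
  is_EM_object T a ->
  flip_ev B A ∘ (idm B ⊗ k) = a ∘ fmap T (flip_ev B A) ∘ lst B (B ⇒ A) ->
  is_EM_object T k.
Proof.
  intros [unit_a assoc_a] Hk.
  pose proof (naturality (eta T) (flip_ev B A)) as eta_nat.
  pose proof (naturality (mu T) (flip_ev B A)) as mu_nat.
  pose proof (lst_eta lst B (B ⇒ A)) as lst_eta_B.
  pose proof (lst_mu lst B (B ⇒ A)) as lst_mu_B.
  split; apply flip_ev_monic.
  (* The types of [eta] and [mu] mention the identity and composite functors;
     rewriting needs these unfolded to their values on objects. *)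
  all: cbn [fob fmap functor_id functor_comp] in *.
  - rewrite prod_map_comp_r, comp_assoc, Hk, prod_map_id, comp_idr.
    rewrite <- comp_assoc, lst_eta_B.
    now rewrite <- comp_assoc, eta_nat, comp_assoc, unit_a, comp_idl.
  - rewrite !prod_map_comp_r, !comp_assoc, Hk.
    transitivity (a ∘ fmap T (a ∘ fmap T (flip_ev B A) ∘ lst B (B ⇒ A))
                    ∘ lst B (T (B ⇒ A))).
    + rewrite <- (comp_assoc _ (lst _ _)), <- lst_mu_B, !comp_assoc.
      rewrite <- (comp_assoc a), mu_nat, comp_assoc, assoc_a.
      now rewrite !fmap_comp, !comp_assoc.
    + (* Naturality brings the inner [k] under [T] next to [flip_ev], where
         its defining equation applies a second time. *)
      rewrite <- (comp_assoc _ (lst _ _)), <- lst_natural, <- Hk.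
      now rewrite fmap_comp, !comp_assoc.
Qed.

Theorem theorem3 (C : CartesianClosedCategory) (T : Monad C)
    (lst : LeftStrength T) (A : EM_object T) (B : C) :
  is_EM_object T (A := B ⇒ A)
    (curry (action A ∘ fmap T (ev B A) ∘ fmap T (swap B (B ⇒ A))
            ∘ lst B (B ⇒ A) ∘ swap (T (B ⇒ A)) B)).
Proof.
  apply (pointwise_action_is_EM_object C T lst A B (action A)).
  - apply EM_objectP.
  - apply flip_ev_transpose.
Qed.
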